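(* Let $G$ be a finite group. Then $G$ is $(2,5)$-centralizer if and only if either $G\cong S_3$, or $Z(G)\neq 1$ and $\frac{G}{Z(G)}\cong \mathbb{Z}_2\times\mathbb{Z}_2$. Moreover, $G$ is primitive $(2,5)$-centralizer if and only if $G\cong S_3$.
   Context: All groups are finite. $Z(G)$ denotes the center of $G$. For a group $G$, $2\text{-}Cent(G) = \{ C_G(\{x,y\}) \mid x,y\in G,\ x\neq y\}$, where $C_G(\{x,y\}) = C_G(x)\cap C_G(y)$. A group $G$ is called $(2,n)$-centralizer if $|2\text{-}Cent(G)| = n$, and primitive $(2,n)$-centralizer if $|2\text{-}Cent(G)| = |2\text{-}Cent(G/Z(G))| = n$. $S_n$ is the symmetric group of degree $n$ and $\mathbb{Z}_n$ the cyclic group of order $n$. *)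

(* Defs.v *)
From mathcomp Require Import all_boot all_fingroup all_solvable all_algebra.

Set Implicit Arguments.
Unset Strict Implicit.
Unset Printing Implicit Defensive.

Local Open Scope group_scope.

Definition two_Cent (gT : finGroupType) (A : {set gT}) : {set {set gT}} :=
  [set 'C_A([set x; y]) | x in A, y in A & x != y].

Definition two_centralizer (n : nat) (gT : finGroupType) (A : {set gT}) : Prop :=
  #|two_Cent A| = n.

Definition primitive_two_centralizer (n : nat) (gT : finGroupType)
    (A : {set gT}) : Prop :=
  #|two_Cent A| = n /\ #|two_Cent (A / 'Z(A))| = n.

(* Main.v *)
Require Import Defs.
From mathcomp Require Import all_boot all_fingroup all_solvable all_algebra.
From mathcomp Require Import zify.

(** If x and y do not commute, then C(x), C(y) and C(xy) are distinct, and
    C(x) :&: C(y) is not the centralizer of any single element.  So a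
    nonabelian G has at least three centralizers of noncentral elements, and if
    |2-Cent(G)| = 5 it has exactly three when Z(G) <> 1 (G itself and
    C(x) :&: C(y) are the other two members) and three or four when Z(G) = 1.
    Three such centralizers force G / Z(G) to be a Klein four-group, which is
    absurd when Z(G) = 1.  In the remaining case C(x) :&: C(y) is the same for
    all noncommuting x and y, hence trivial, so commutation is transitive on
    nontrivial elements and the four centralizers partition G; counting elements
    gives |G| = 6. *)

Set Implicit Arguments.
Unset Strict Implicit.
Unset Printing Implicit Defensive.

Local Open Scope group_scope.

(** An elementary abelian group is determined up to isomorphism by its prime and its order, so these
    facts suffice to recognize the Klein four-group. *)
Lemma abelem_Z2_Z2 : 2.-abelem [set: 'Z_2 * 'Z_2] /\ #|[set: 'Z_2 * 'Z_2]| = 4.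
Proof.
have oV: #|[set: 'Z_2 * 'Z_2]| = 4 by rewrite cardsT card_prod card_ord.
split=> //; rewrite abelemE // (@card_p2group_abelian _ 2) //=.
apply/exponentP=> -[u v] _; apply/eqP.
by case: u v => [[|[|[]]] //= ?] [[|[|[]]] //= ?].
Qed.

(** * Centralizers of noncentral elements and of noncommuting pairs *)

Section Centralizers.

Variables (gT : finGroupType) (G : {group gT}).
Implicit Types (u v w x y : gT) (A B : {set gT}).

Definition noncentral_cents : {set {set gT}} :=
  [set 'C_G[w] | w in G :\: 'Z(G)].

Definition three_cents x y : {set {set gT}} :=
  'C_G[x] |: [set 'C_G[y]; 'C_G[x * y]].

Lemma mem_three_cents A x y : (A \in three_cents x y) =
  [|| A == 'C_G[x], A == 'C_G[y] | A == 'C_G[x * y]].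
Proof. by rewrite !inE. Qed.

Lemma subcent_set2 x y : 'C_G([set x; y]) = 'C_G[x] :&: 'C_G[y].
Proof. by rewrite centU !cent_set1 setIACA setIid. Qed.

Lemma noncentralP x :
  reflect (exists y, [/\ x \in G, y \in G & y \notin 'C[x]])
          (x \in G :\: 'Z(G)).
Proof.
apply: (iffP setDP) => [[Gx] | [y [Gx Gy ncxy]]].
  rewrite inE Gx -sub_cent1 => /subsetPn[y Gy ncxy].
  by exists y.
split=> //; apply: contra ncxy => /centerP[_ cx].
by rewrite cent1C; apply/cent1P/cx.
Qed.

Lemma nonabelianP :
  reflect (exists x y, [/\ x \in G, y \in G & y \notin 'C[x]]) (~~ abelian G).
Proof.
apply: (iffP idP) => [/subsetPn[x Gx] | [x [y [Gx Gy ncxy]]]].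
  rewrite -sub_cent1 => /subsetPn[y Gy ncxy].
  by exists x, y.
by apply: contra ncxy => cGG; apply/cent1P; apply: (centsP cGG).
Qed.

Lemma noncentral_subcent x y : x \in G -> y \in G -> y \notin 'C[x] ->
  'C_G[x] \in noncentral_cents.
Proof. by move=> Gx Gy ncxy; apply: imset_f; apply/noncentralP; exists y. Qed.

Lemma subcent1_neq x y : y \in G -> y \notin 'C[x] -> 'C_G[x] != 'C_G[y].
Proof.
move=> Gy ncxy; apply: contra ncxy => /eqP eqC.
by have := subcent1_id Gy; rewrite -eqC => /setIP[].
Qed.

Lemma notin_cent1_mul x y : y \notin 'C[x] ->
  (x * y \notin 'C[x]) * (x * y \notin 'C[y]).
Proof. by move=> ncxy; rewrite groupMl ?groupMr ?cent1id // [x \in _]cent1C. Qed.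

Section NoncommutingPair.

Variables x y : gT.
Hypotheses (Gx : x \in G) (Gy : y \in G) (ncxy : y \notin 'C[x]).

(** C(x) omits [y], while C(y) and C(x * y) omit [x]. *)
Lemma mem_subcent2_three_cents w :
  'C_G[w] \in three_cents x y -> x \in 'C[w] -> y \in 'C[w] -> False.
Proof.
have [ncxxy ncyxy] := notin_cent1_mul ncxy.
rewrite mem_three_cents => Cw cwx cwy; case/or3P: Cw => /eqP/setP eqC.
- by have := eqC y; rewrite !in_setI Gy cwy (negPf ncxy).
- by have := eqC x; rewrite !in_setI Gx cwx cent1C (negPf ncxy).
- by have := eqC x; rewrite !in_setI Gx cwx cent1C (negPf ncxxy).
Qed.

(** If they agreed, [w] would commute with [x] and [y], so [y] would lie in ['C_G[w]] and hence in
    ['C_G[x]]. *)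
Lemma subcent1_neq_subcent2 w : w \in G -> 'C_G[w] != 'C_G[x] :&: 'C_G[y].
Proof.
move=> Gw; apply: contraNneq ncxy => eqC.
have:= subcent1_id Gw; rewrite eqC => /setIP[/setIP[_ cxw] /setIP[_ cyw]].
have: y \in 'C_G[w] by rewrite in_setI Gy cent1C.
by rewrite eqC => /setIP[/setIP[]].
Qed.

Lemma card_three_cents : #|three_cents x y| = 3.
Proof.
have [ncxxy ncyxy] := notin_cent1_mul ncxy.
have Gxy := groupM Gx Gy.
by rewrite cardsU1 cards2 !inE negb_or !subcent1_neq.
Qed.

Lemma sub_three_cents : three_cents x y \subset noncentral_cents.
Proof.
have [ncxxy ncyxy] := notin_cent1_mul ncxy.
have Gxy := groupM Gx Gy.
apply/subsetP=> A; rewrite mem_three_cents => /or3P[] /eqP->.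
- exact: noncentral_subcent ncxy.
- by apply: (@noncentral_subcent _ x) => //; rewrite cent1C.
- by apply: (@noncentral_subcent _ x) => //; rewrite cent1C.
Qed.

Lemma subcent2_notin : 'C_G[x] :&: 'C_G[y] \notin noncentral_cents.
Proof.
apply/negP=> /imsetP[w /setDP[Gw _] eqC].
by have := subcent1_neq_subcent2 Gw; rewrite eqC eqxx.
Qed.

Lemma subcent2_two_Cent : 'C_G[x] :&: 'C_G[y] \in two_Cent G.
Proof.
rewrite -subcent_set2; apply: imset2_f => //; rewrite inE Gy /=.
by apply: contraNneq ncxy => ->; apply: cent1id.
Qed.

End NoncommutingPair.

Lemma group_notin_noncentral : gval G \notin noncentral_cents.
Proof.
apply/negP=> /imsetP[w /noncentralP[y [_ Gy ncwy]] /setP/(_ y)].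
by rewrite in_setI Gy (negPf ncwy).
Qed.

Lemma noncentral_sub_two_Cent : noncentral_cents \subset two_Cent G.
Proof.
apply/subsetP=> _ /imsetP[w /setDP[Gw Zw] ->].
have ->: 'C_G[w] = 'C_G([set 1; w]).
  by rewrite subcent_set2 cent11T setIT setIA setIid.
apply: imset2_f => //; rewrite inE Gw /=.
by apply: contraNneq Zw => <-.
Qed.

Lemma group_two_Cent : 'Z(G) != 1 -> gval G \in two_Cent G.
Proof.
case/trivgPn=> z /setIP[Gz cGz] ntz.
apply/imset2P; exists 1 z => //; first by rewrite inE Gz /= eq_sym.
by rewrite subcent_set2 cent11T setIT setIA setIid (setIidPl _) // sub_cent1.
Qed.

(** * Three noncentral centralizers: the quotient by the center *)

Section ThreeCentralizers.

Hypotheses (nabG : ~~ abelian G) (card_cents : #|noncentral_cents| = 3).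

Lemma noncentral_three x y : x \in G -> y \in G -> y \notin 'C[x] ->
  noncentral_cents = three_cents x y.
Proof.
move=> Gx Gy ncxy; apply/esym/eqP.
by rewrite eqEcard sub_three_cents // card_cents card_three_cents.
Qed.

(** A noncentral [w] would have its centralizer among the three, none of which contains both [x] and
    [y]. *)
Lemma mem_center_three x y w : x \in G -> y \in G -> y \notin 'C[x] ->
  w \in G -> x \in 'C[w] -> y \in 'C[w] -> w \in 'Z(G).
Proof.
move=> Gx Gy ncxy Gw cwx cwy; apply: contraT => Zw.
suffices: 'C_G[w] \in three_cents x y.
  by move/mem_subcent2_three_cents=> []//.
by rewrite -noncentral_three //; apply: imset_f; rewrite inE Zw.
Qed.

(* C(w * y) differs from C(w) = C(x) and from C(y), so it is C(x * y): then
   w * x^-1 = (w * y) * (x * y)^-1 centralizes x and x * y, and is central. *)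
Lemma subcent1_mull x y w : x \in G -> y \in G -> y \notin 'C[x] ->
  w \in G -> 'C_G[w] = 'C_G[x] -> w * x^-1 \in 'Z(G).
Proof.
move=> Gx Gy ncxy Gw eqC; have Gwy := groupM Gw Gy.
have ncwy: y \notin 'C[w].
  by apply: contra ncxy => cwy; have/setP/(_ y) := eqC; rewrite !in_setI Gy cwy.
have [ncwwy ncywy] := notin_cent1_mul ncwy.
have: 'C_G[w * y] \in noncentral_cents.
  by apply: (@noncentral_subcent _ w) => //; rewrite cent1C.
rewrite (noncentral_three Gx Gy ncxy) mem_three_cents -eqC.
rewrite eq_sym (negPf (subcent1_neq _ ncwwy)) //.
rewrite eq_sym (negPf (subcent1_neq _ ncywy)) //= => /eqP eqCxy.
have /setIP[_ cxy_wy]: w * y \in 'C_G[x * y] by rewrite -eqCxy subcent1_id.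
have cx_w: w * x^-1 \in 'C[x].
  have /setIP[_ cxw]: w \in 'C_G[x] by rewrite -eqC subcent1_id.
  by rewrite groupM // groupV cent1id.
have cxy_w: w * x^-1 \in 'C[x * y].
  have ->: w * x^-1 = (w * y) * (x * y)^-1 by rewrite invMg mulgA mulgK.
  by rewrite groupM // groupV cent1id.
have cw_x: x \in 'C[w * x^-1] by rewrite cent1C.
apply: (@mem_center_three x y) => //; first by rewrite groupM ?groupV.
by rewrite cent1C in cxy_w; rewrite groupMl in cxy_w.
Qed.

(** By [subcent1_mull], the centralizer of a noncentral element determines its coset of ['Z(G)];
    with the trivial coset this makes at most four. *)
Lemma abelem_quotient_center : 2.-abelem (G / 'Z(G)) /\ #|G / 'Z(G)| = 4.
Proof.
have nZG: G \subset 'N('Z(G)) := normal_norm (center_normal G).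
have oQ: #|G / 'Z(G)| = 4.
  apply/eqP; rewrite eqn_leq; apply/andP; split; last first.
    (* A group of order at most 3 is cyclic, and a cyclic quotient by the center makes [G]
       abelian. *)
    rewrite ltnNge; apply: contra nabG => /cyclic_small.
    exact: cyclic_center_factor_abelian.
  have/nonabelianP[x [y [Gx Gy ncxy]]] := nabG.
  rewrite card_quotient //.
  have Gxy := groupM Gx Gy; have [ncxxy ncyxy] := notin_cent1_mul ncxy.
  have ncyx: x \notin 'C[y] by rewrite cent1C.
  have ncxyx: x \notin 'C[x * y] by rewrite cent1C.
  pose S := 'Z(G) :* 1 |: ('Z(G) :* x |: [set 'Z(G) :* y; 'Z(G) :* (x * y)]).
  have: rcosets 'Z(G) G \subset S.
    apply/subsetP=> _ /rcosetsP[w Gw ->]; rewrite !inE.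
    have [Zw | Zw] := boolP (w \in 'Z(G)).
      by rewrite mulg1 rcoset_id // eqxx.
    have: 'C_G[w] \in noncentral_cents by apply: imset_f; rewrite inE Zw.
    rewrite (noncentral_three Gx Gy ncxy) mem_three_cents.
    have eqZ v : w * v^-1 \in 'Z(G) -> 'Z(G) :* w == 'Z(G) :* v.
      by move=> Zwv; apply/eqP/rcoset_eqP; rewrite mem_rcoset.
    case/or3P=> /eqP eqC.
    - by rewrite (eqZ _ (subcent1_mull Gx Gy ncxy Gw eqC)) ?orbT.
    - by rewrite (eqZ _ (subcent1_mull Gy Gx ncyx Gw eqC)) ?orbT.
    - by rewrite (eqZ _ (subcent1_mull Gxy Gx ncxyx Gw eqC)) ?orbT.
  move/subset_leq_card/leq_trans; apply.
  by rewrite !cardsU1 cards1; do 3!case: (_ \notin _).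
split=> //; rewrite abelemE // (@card_p2group_abelian _ 2) //=.
apply/exponentP=> _ /morphimP[x Nx Gx ->]; rewrite -morphX //.
apply: coset_id; have [Zx | Zx] := boolP (x \in 'Z(G)); first by rewrite groupX.
have /noncentralP[y [_ Gy ncxy]]: x \in G :\: 'Z(G) by rewrite inE Zx.
(* Since C(x^-1) = C(x), [subcent1_mull] applied to x^-1 and [x] puts x^-2 in the center. *)
rewrite -groupV -expgVn expgS expg1.
by apply: (@subcent1_mull x y); rewrite ?groupV // -cent_cycle cycleV cent_cycle.
Qed.

(** If [x] and [y] commuted, C(y) would contain [x]; among the three centralizers built from [x] and
    some [b] not commuting with it, only C(x) does. So they do not commute, and [mem_center_three]
    applies. *)
Lemma subcent2_three x y : x \in G :\: 'Z(G) -> y \in G :\: 'Z(G) ->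
  'C_G[x] != 'C_G[y] -> 'C_G[x] :&: 'C_G[y] = 'Z(G).
Proof.
case/noncentralP=> b [Gx Gb ncxb] ZGy neqC.
have /setDP[Gy _] := ZGy.
have ncxy: y \notin 'C[x].
  apply: contra neqC => cxy.
  have: 'C_G[y] \in noncentral_cents by apply: imset_f.
  have [ncxxb ncbxb] := notin_cent1_mul ncxb.
  rewrite (noncentral_three Gx Gb ncxb) mem_three_cents eq_sym.
  case/or3P=> // /eqP/setP/(_ x); rewrite !in_setI Gx [x \in 'C[y]]cent1C cxy cent1C.
    by rewrite (negPf ncxb).
  by rewrite (negPf ncxxb).
apply/eqP; rewrite eqEsubset; apply/andP; split; apply/subsetP=> w.
  case/setIP=> /setIP[Gw cxw] /setIP[_ cyw].
  by apply: (mem_center_three Gx Gy) => //; rewrite cent1C.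
case/centerP=> Gw cw; rewrite !in_setI Gw /=.
by apply/andP; split; apply/cent1P/cw.
Qed.

End ThreeCentralizers.

(** * Trivial intersections: partition into centralizers and counting *)

Section CommutingTransitive.

Hypothesis nabG : ~~ abelian G.
Hypothesis TI_cent : forall x y, x \in G -> y \in G -> y \notin 'C[x] ->
  'C_G[x] :&: 'C_G[y] = 1.

Lemma center_TI_cent : 'Z(G) = 1.
Proof.
have/nonabelianP[x [y [Gx Gy ncxy]]] := nabG.
apply/trivgP; rewrite -(TI_cent Gx Gy ncxy).
by rewrite subsetI !setIS // -cent_set1 centS // sub1set.
Qed.

(** An element of C(w) not commuting with [x] would put [w] in a trivial intersection. *)
Lemma subcent1_subset x w : x \in G -> w \in 'C_G[x] -> w != 1 ->
  'C_G[w] \subset 'C_G[x].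
Proof.
move=> Gx /setIP[Gw cxw] ntw; apply/subsetP=> v /setIP[Gv cwv].
rewrite inE Gv; apply: contraNT ntw => ncxv.
rewrite -in_set1 -[[set 1]](TI_cent Gx Gv ncxv).
by rewrite !in_setI Gw cxw cent1C.
Qed.

Lemma subcent1_transitive x w : x \in G -> x != 1 -> w \in 'C_G[x] -> w != 1 ->
  'C_G[w] = 'C_G[x].
Proof.
move=> Gx ntx cxw ntw; apply/eqP; rewrite eqEsubset subcent1_subset //=.
have /setIP[Gw cwx] := cxw.
by rewrite subcent1_subset // inE Gx cent1C.
Qed.

Lemma noncentral_centsP A :
  reflect (exists w, [/\ w \in G, w != 1 & A = 'C_G[w]])
          (A \in noncentral_cents).
Proof.
rewrite /noncentral_cents center_TI_cent.
apply: (iffP imsetP) => [[w /setD1P[ntw Gw] ->] | [w [Gw ntw ->]]].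
  by exists w.
by exists w => //; rewrite !inE ntw.
Qed.

Lemma TI_noncentral_cents A B :
  A \in noncentral_cents -> B \in noncentral_cents -> A != B -> A :&: B = 1.
Proof.
case/noncentral_centsP=> x [Gx ntx ->] /noncentral_centsP[y [Gy nty ->]] neq.
apply/trivgP/subsetP=> w /setIP[cxw cyw]; rewrite inE.
apply: contraNT neq => ntw.
by rewrite -(subcent1_transitive Gx ntx cxw ntw) (subcent1_transitive Gy).
Qed.

Lemma mul_card_noncentral_cents A B :
  A \in noncentral_cents -> B \in noncentral_cents -> A != B ->
  (#|A| * #|B| <= #|G|)%N.
Proof.
move=> PA PB neq; have := TI_noncentral_cents PA PB neq.
case/noncentral_centsP: PA => x [Gx _ ->]; case/noncentral_centsP: PB => y [Gy _ ->].
by move=> /= TI; rewrite -TI_cardMg // subset_leq_card // mul_subG ?subsetIl.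
Qed.

(** Each nontrivial [w] is counted under ['C_G[w]]; by [subcent1_transitive], a member [A] collects
    exactly its elements other than [1]. *)
Lemma sum_card_noncentral_cents :
  (\sum_(A in noncentral_cents) #|A|.-1 = #|G|.-1)%N.
Proof.
rewrite [in RHS](cardsD1 1) group1 add1n /= -sum1_card.
rewrite (partition_big (fun w => 'C_G[w]) (mem noncentral_cents)) /=; last first.
  by move=> w /setD1P[ntw Gw]; apply/noncentral_centsP; exists w.
apply: eq_bigr => A /noncentral_centsP[x [Gx ntx ->]].
rewrite [in LHS](cardsD1 1) group1 add1n /= -sum1_card.
apply: eq_bigl => w; rewrite 2!in_setD1.
have [// | ntw] := eqVneq w 1; rewrite /=.
apply/idP/andP=> [cxw | [Gw /eqP <-]]; last exact: subcent1_id.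
by rewrite (subcent1_transitive Gx) //; case/setIP: cxw.
Qed.

(** The extra member is the trivial group, given by noncommuting pairs. A pair containing [1] gives
    the centralizer of its other element, and commuting nontrivial elements have the same
    centralizer. *)
Lemma card_two_Cent_TI : #|two_Cent G| = #|noncentral_cents|.+1.
Proof.
have/nonabelianP[x [y [Gx Gy ncxy]]] := nabG.
have TIxy := TI_cent Gx Gy ncxy.
have P1 : [1 gT] \notin noncentral_cents by rewrite -TIxy subcent2_notin.
have ->: two_Cent G = [1 gT] |: noncentral_cents; last by rewrite cardsU1 P1.
apply/eqP; rewrite eqEsubset subUset sub1set noncentral_sub_two_Cent.
rewrite -{2}TIxy subcent2_two_Cent // !andbT.
apply/subsetP=> _ /imset2P[u v Gu /setIdP[Gv neq_uv] ->].
rewrite subcent_set2 in_setU1.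
have [u1 | ntu] := eqVneq u 1.
  apply/orP; right; apply/noncentral_centsP; exists v.
  by rewrite u1 eq_sym in neq_uv *; rewrite cent11T setIT setIA setIid.
have [v1 | ntv] := eqVneq v 1.
  apply/orP; right; apply/noncentral_centsP; exists u.
  by rewrite v1 cent11T setIT -setIA [_ :&: G]setIC setIA setIid.
have [cuv | ncuv] := boolP (v \in 'C[u]); last by rewrite TI_cent ?eqxx.
apply/orP; right; apply/noncentral_centsP; exists u.
by rewrite (subcent1_transitive Gu ntu _ ntv) ?setIid // inE Gv.
Qed.

(* If a is the largest order among the four members and |G| = k a, the other
   members have order at most min(a, k), since members meet trivially; thus
   k a + 3 <= a + 3 min(a, k), which gives a, k <= 3 and |G| = 4, 6 or 9. *)
Lemma card6_of_four_cents : #|noncentral_cents| = 4 -> #|G| = 6.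
Proof.
move=> cards4.
have pos A : A \in noncentral_cents -> (0 < #|A|)%N.
  by case/noncentral_centsP=> w [_ _ ->]; apply: cardG_gt0.
(* Each of the four members gets its identity back: (|G| - 1) + 4. *)
have sumP : (\sum_(A in noncentral_cents) #|A| = #|G| + 3)%N.
  have := sum_card_noncentral_cents; have := cardG_gt0 G.
  have ->: (\sum_(A in noncentral_cents) #|A|
     = \sum_(A in noncentral_cents) (#|A|.-1 + 1))%N.
    by apply: eq_bigr => A /pos/prednK; rewrite addn1.
  by rewrite big_split /= sum1_card cards4; lia.
have /card_gt0P[B0 PB0]: (0 < #|noncentral_cents|)%N by rewrite cards4.
have [A PA maxA] := @arg_maxnP _ B0 (mem noncentral_cents) (fun A => #|A|) PB0.
have {}PA : A \in noncentral_cents := PA.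
have [w [Gw ntw defA]] := noncentral_centsP _ PA.
have [k oG] : exists k, #|G| = (k * #|A|)%N.
  by apply/dvdnP; rewrite defA; apply: cardSg; apply: subsetIl.
have le_k B : B \in noncentral_cents :\ A -> (#|B| <= k)%N.
  case/setD1P=> neqBA PB; rewrite -(leq_pmul2r (pos A PA)) -oG.
  exact: mul_card_noncentral_cents.
have sumA (m : nat) : (forall B, B \in noncentral_cents :\ A -> #|B| <= m)%N ->
    (#|G| + 3 <= #|A| + 3 * m)%N.
  move=> le_m; rewrite -sumP (big_setD1 A) //= leq_add2l.
  apply: leq_trans (leq_sum _ le_m) _; rewrite sum_nat_const.
  by have := cardsD1 A noncentral_cents; rewrite PA cards4 add1n => -[<-].
have le1 := sumA k le_k.
have le2 : (#|G| + 3 <= #|A| + 3 * #|A|)%N.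
  by apply: sumA => B /setD1P[_ PB]; apply: maxA.
have k_gt1 : (1 < k)%N.
  have : (#|A| < #|G|)%N.
    rewrite proper_card // properEneq defA subsetIl -defA andbT.
    by apply: contraTneq PA => ->; apply: group_notin_noncentral.
  by rewrite oG; nia.
have p2 p : prime p -> #|G| = (p ^ 2)%N -> False.
  by move=> pr_p /(card_p2group_abelian pr_p) => cGG; have := nabG; rewrite cGG.
have nG4 : #|G| <> 4 by apply: (p2 2).
have nG9 : #|G| <> 9 by apply: (p2 3).
(* [le1] amounts to (k - 1)(|A| - 3) <= 0 and bounds |A|; [le2] amounts to k |A| + 3 <= 4 |A| and
   bounds [k]. *)
have leA3: (#|A| <= 3)%N by nia.
have lek3: (k <= 3)%N by nia.
nia.
Qed.

End CommutingTransitive.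

(** * Bounds on the number of members *)

Lemma card_noncentral_cents_ge3 : ~~ abelian G -> (3 <= #|noncentral_cents|)%N.
Proof.
case/nonabelianP=> x [y [Gx Gy ncxy]].
by rewrite -(card_three_cents Gx Gy ncxy) subset_leq_card // sub_three_cents.
Qed.

(** The two extra members are [G], from [1] and a nontrivial central element, and the intersection
    for a noncommuting pair. They differ, and neither is the centralizer of a noncentral element. *)
Lemma card_two_Cent_ge_center : ~~ abelian G -> 'Z(G) != 1 ->
  (#|noncentral_cents|.+2 <= #|two_Cent G|)%N.
Proof.
case/nonabelianP=> x [y [Gx Gy ncxy]] ntZ.
have TnC := subcent2_notin Gy ncxy; have GnC := group_notin_noncentral.
suffices: gval G |: ('C_G[x] :&: 'C_G[y] |: noncentral_cents) \subset two_Cent G.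
  move/subset_leq_card; rewrite !cardsU1 TnC in_setU1 (negPf GnC) orbF.
  suffices ->: gval G != 'C_G[x] :&: 'C_G[y] by [].
  by apply: contraNneq ncxy => eqG; move: Gy; rewrite {1}eqG => /setIP[/setIP[]].
rewrite !subUset !sub1set group_two_Cent // subcent2_two_Cent //=.
exact: noncentral_sub_two_Cent.
Qed.

Lemma two_Cent_abelian : abelian G -> (#|two_Cent G| <= 1)%N.
Proof.
move=> cGG; rewrite -(cards1 (gval G)) subset_leq_card //.
apply/subsetP=> _ /imset2P[u v Gu /setIdP[Gv _] ->].
rewrite inE subcent_set2 setIACA setIid; apply/eqP/setIidPl.
by rewrite subsetI !sub_cent1 !(subsetP cGG).
Qed.

(** C(w) depends only on the coset of [w] modulo the center. The inequality is strict because the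
    trivial coset yields [G], which is not in [noncentral_cents]. *)
Lemma card_noncentral_cents_le_index :
  (#|noncentral_cents| < #|G : 'Z(G)|)%N.
Proof.
have <-: #|gval G |: noncentral_cents| = #|noncentral_cents|.+1.
  by rewrite cardsU1 group_notin_noncentral.
pose f (A : {set gT}) := 'C_G[repr A].
apply: leq_trans (leq_imset_card f _); apply: subset_leq_card.
have sub w : w \in G -> 'C_G[w] \in [set f A | A in rcosets 'Z(G) G].
  move=> Gw; apply/imsetP; exists ('Z(G) :* w); first by apply/rcosetsP; exists w.
  rewrite /f; case: repr_rcosetP => z /centerP[Gz cz].
  apply/setP=> v; rewrite !in_setI; have [Gv | //] := boolP (v \in G).
  have czv: z \in 'C[v] by apply/cent1P/cz.
  by rewrite /= ![v \in _]cent1C groupMl.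
rewrite subUset sub1set; apply/andP; split.
  by rewrite -{1}[gval G]setIT -cent11T sub.
by apply/subsetP=> _ /imsetP[w /setDP[Gw _] ->]; apply: sub.
Qed.

(** Index 4 leaves exactly three noncentral centralizers; distinct ones meet in ['Z(G)], so the only
    further members are [G] and ['Z(G)]. *)
Lemma two_centralizer5_center : 'Z(G) != 1 -> #|G / 'Z(G)| = 4 ->
  two_centralizer 5 G.
Proof.
move=> ntZ; rewrite card_quotient ?normal_norm ?center_normal //= => iZG.
have nabG: ~~ abelian G.
  by apply: contra_eqN iZG => /center_idP->; rewrite indexgg.
have card_nc: #|noncentral_cents| = 3.
  apply/eqP; rewrite eqn_leq card_noncentral_cents_ge3 // andbT -ltnS -iZG.
  exact: card_noncentral_cents_le_index.
apply/eqP; rewrite eqn_leq -{2}card_nc card_two_Cent_ge_center // andbT.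
have: two_Cent G \subset gval G |: ('Z(G) |: noncentral_cents).
  apply/subsetP=> _ /imset2P[u v Gu /setIdP[Gv _] ->]; rewrite subcent_set2.
  have sub w : w \in 'Z(G) -> 'C_G[w] = G.
    by case/setIP=> Gw cGw; apply/setIidPl; rewrite sub_cent1.
  have nonc w : w \in G -> w \notin 'Z(G) -> 'C_G[w] \in noncentral_cents.
    by move=> Gw Zw; apply: imset_f; rewrite inE Zw.
  rewrite !in_setU1.
  have [Zu | Zu] := boolP (u \in 'Z(G)).
    rewrite (sub u) // setIA setIid.
    have [Zv | Zv] := boolP (v \in 'Z(G)); first by rewrite sub // eqxx.
    by rewrite nonc ?orbT.
  have [Zv | Zv] := boolP (v \in 'Z(G)).
    by rewrite (sub v) // setIAC setIid nonc ?orbT.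
  have [<- | neqC] := eqVneq 'C_G[u] 'C_G[v]; first by rewrite setIid nonc ?orbT.
  by rewrite subcent2_three ?eqxx ?orbT // inE ?Zu ?Zv.
move/subset_leq_card/leq_trans; apply; rewrite !cardsU1 card_nc.
by do 2!case: (_ \notin _).
Qed.

Lemma card6_of_two_centralizer5 : two_centralizer 5 G -> 'Z(G) = 1 ->
  ~~ abelian G -> #|G| = 6.
Proof.
rewrite /two_centralizer => card5 Z1 nabG.
have [x [y [Gx Gy ncxy]]] := nonabelianP nabG.
have sub u v : u \in G -> v \in G -> v \notin 'C[u] ->
    'C_G[u] :&: 'C_G[v] |: noncentral_cents \subset two_Cent G.
  by move=> Gu Gv ncuv; rewrite subUset sub1set subcent2_two_Cent //
    noncentral_sub_two_Cent.
have card_sub u v : u \in G -> v \in G -> v \notin 'C[u] ->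
    #|'C_G[u] :&: 'C_G[v] |: noncentral_cents| = #|noncentral_cents|.+1.
  by move=> Gu Gv ncuv; rewrite cardsU1 subcent2_notin.
have ge3 := card_noncentral_cents_ge3 nabG.
have := subset_leq_card (sub x y Gx Gy ncxy).
rewrite card_sub // card5 ltnS leq_eqVlt => /orP[/eqP cards4 | lt4]; last first.
  (* With a trivial center, three centralizers would give |G| = 4 and make [G] abelian. *)
  have card3: #|noncentral_cents| = 3 by apply/eqP; rewrite eqn_leq ge3 andbT.
  have [_] := abelem_quotient_center nabG card3.
  rewrite Z1 -(card_isog (quotient1_isog G)) => oG.
  by move: nabG; rewrite (@card_p2group_abelian _ 2 G).
have eqT u v : u \in G -> v \in G -> v \notin 'C[u] ->
    'C_G[u] :&: 'C_G[v] |: noncentral_cents = two_Cent G.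
  by move=> Gu Gv ncuv; apply/eqP; rewrite eqEcard sub // card_sub // cards4 card5.
apply: card6_of_four_cents => // u v Gu Gv ncuv.
apply/trivgP/subsetP=> w Tw; rewrite inE; apply/idPn => ntw.
have Gw: w \in G by case/setIP: Tw => /setIP[].
have /noncentralP[a [_ Ga ncwa]]: w \in G :\: 'Z(G) by rewrite Z1 !inE ntw.
(* [two_Cent G] has a single member outside [noncentral_cents], so the pairs [u], [v] and [w], [a]
   share it; but [w] lies in it and not in C(a). *)
have: 'C_G[u] :&: 'C_G[v] \in 'C_G[w] :&: 'C_G[a] |: noncentral_cents.
  by rewrite eqT // -(eqT u v) // setU11.
rewrite in_setU1 (negPf (subcent2_notin Gv ncuv)) orbF => /eqP eqTw.
have: w \in 'C_G[u] :&: 'C_G[v] by [].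
by rewrite eqTw => /setIP[_ /setIP[_]]; rewrite cent1C (negPf ncwa).
Qed.

(** * Nonabelian groups of order six *)

Section OrderSix.

Hypotheses (oG : #|G| = 6) (nabG : ~~ abelian G).

(** The orders of the intersection, of C(x) and of [G] form a strict chain of divisors ending at 6,
    so the first is 1. *)
Lemma TI_cent_order6 x y : x \in G -> y \in G -> y \notin 'C[x] ->
  'C_G[x] :&: 'C_G[y] = 1.
Proof.
move=> Gx Gy ncxy; apply: card1_trivg.
have dCG: (#|'C_G[x]| %| 6)%N by rewrite -oG cardSg ?subsetIl.
have dDC: (#|'C_G[x] :&: 'C_G[y]| %| #|'C_G[x]|)%N by rewrite cardSg ?subsetIl.
have ltCG: (#|'C_G[x]| < 6)%N.
  rewrite -oG proper_card // properE subsetIl.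
  by apply: contra ncxy => /subsetP/(_ y Gy)/setIP[].
have ltDC: (#|'C_G[x] :&: 'C_G[y]| < #|'C_G[x]|)%N.
  rewrite proper_card // properE subsetIl.
  apply: contra ncxy => /subsetP/(_ x (subcent1_id Gx))/setIP[_ /setIP[_]].
  by rewrite cent1C.
move=> /=; move: #|'C_G[x] :&: _| #|'C_G[x]| dCG dDC ltCG ltDC.
by case=> [|[|[|[|[|[|d]]]]]] [|[|[|[|[|[|c]]]]]].
Qed.

(** The sum in [sum_card_noncentral_cents] is 5, and the centralizer of an element of order 3
    contributes 2. Any other member has order 2, as 3 times its order is at most 6, and contributes
    1; so there are three others. *)
Lemma two_centralizer5_order6 : two_centralizer 5 G.
Proof.
rewrite /two_centralizer card_two_Cent_TI //; last exact: TI_cent_order6.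
congr _.+1.
have [x Gx ox] : {x | x \in G & #[x] = 3} by apply: Cauchy; rewrite ?oG.
have ntx : x != 1 by rewrite -order_gt1 ox.
have cP := noncentral_centsP nabG TI_cent_order6.
have PA : 'C_G[x] \in noncentral_cents by apply/cP; exists x.
have oA : #|'C_G[x]| = 3.
  have dCG: (#|'C_G[x]| %| 6)%N by rewrite -oG cardSg ?subsetIl.
  have d3C: (3 %| #|'C_G[x]|)%N by rewrite -ox cardSg // cycle_subG subcent1_id.
  have: #|'C_G[x]| != 6.
    rewrite -oG; apply: contraTneq PA => eqG.
    have ->: 'C_G[x] = G by apply/eqP; rewrite eqEcard subsetIl eqG /=.
    exact: group_notin_noncentral.
  move: #|_| dCG d3C (dvdn_leq (isT : 0 < 6)%N dCG).
  by case=> [|[|[|[|[|[|[|c]]]]]]].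
have := sum_card_noncentral_cents nabG TI_cent_order6.
rewrite oG (big_setD1 _ PA) /= oA (cardsD1 'C_G[x]) PA.
rewrite (eq_bigr (fun=> 1%N)) => [|B /setD1P[neqB PB]]; last first.
  have := mul_card_noncentral_cents nabG TI_cent_order6 PB PA neqB.
  rewrite oG oA; have /cP[w [Gw ntw defB]] := PB.
  have: (1 < #|B|)%N.
    by rewrite defB cardG_gt1; apply/trivgPn; exists w => //; apply: subcent1_id.
  by move: #|B| => [|[|[|]]].
by rewrite sum1_card; lia.
Qed.

(** Generators of orders 3 and 2 satisfy the dihedral relations, so [G] is a homomorphic image of
    ['D_6], of the same order. *)
Lemma isog_dihedral6 : G \isog [set: 'D_6].
Proof.
have [x Gx ox] : {x | x \in G & #[x] = 3} by apply: Cauchy; rewrite ?oG.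
have [y Gy oy] : {y | y \in G & #[y] = 2} by apply: Cauchy; rewrite ?oG.
have sXG: <[x]> \subset G by rewrite cycle_subG.
have sYG: <[y]> \subset G by rewrite cycle_subG.
have nXG: <[x]> <| G.
  by apply: index2_normal => //; rewrite -divgS // oG -orderE ox.
have defG: <[x]> <*> <[y]> = G.
  apply/eqP; rewrite eqEcard join_subG sXG sYG /= oG dvdn_leq ?cardG_gt0 //.
  rewrite (@Gauss_dvd 2 3) // -{1}oy -ox.
  by rewrite !cardSg ?joing_subl ?joing_subr.
have nXy: y \in 'N(<[x]>) by rewrite (subsetP (normal_norm nXG)).
have [e xye]: exists e, x ^ y = x ^+ e.
  by apply/cycleP; rewrite memJ_norm ?cycle_id.
have xy: x ^ y = x^-1.
  move: xye; rewrite -(expg_mod_order x e) ox.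
  have: (e %% 3 < 3)%N by rewrite ltn_mod.
  (* Exponent 0 would make [x] trivial, exponent 1 would make [G] abelian, and exponent 2 is
     inversion. *)
  case: (e %% 3)%N => [|[|[|//]]] _ xye.
  - have: #[x ^ y] = 1%N by rewrite xye order1.
    by rewrite orderJ ox.
  - have cxy: y \in 'C[x].
      by rewrite cent1C; apply/cent1P/commgP/conjg_fixP; rewrite xye.
    move: nabG; rewrite -defG abelianY !cycle_abelian cycle_subG /=.
    by rewrite cent_cycle cxy.
  - by apply/eqP; rewrite xye eq_sym eq_invg_mul -expgS -ox expg_order.
rewrite -[6]/(3.*2) isogEcard card_dihedral // oG andbT.
rewrite Grp_dihedral //.
apply/existsP; exists (x, y); rewrite /= !xpair_eqE defG xy !eqxx /=.
by rewrite -{1}ox -oy !expg_order !eqxx.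
Qed.

End OrderSix.

End Centralizers.

(** * Recognition of the symmetric group and the final equivalences *)

Lemma isog_S3P (gT : finGroupType) (G : {group gT}) :
  reflect (#|G| = 6 /\ ~~ abelian G) (G \isog [set: 'S_3]).
Proof.
have oS : #|[set: 'S_3]| = 6 by rewrite cardsT card_Sn.
have nabS : ~~ abelian [set: 'S_3].
  (* The two products of these transpositions disagree at 0: one sends it to 1, the other to 2. *)
  apply/nonabelianP; exists (tperm ord0 (inord 1)), (tperm ord0 ord_max).
  split; rewrite ?in_setT //; apply/cent1P=> /permP/(_ ord0)/eqP.
  by rewrite !permM !tpermL !tpermD // -val_eqE /= !inordK.
apply: (iffP idP) => [isoG | [oG nabG]].
  by rewrite (card_isog isoG) (isog_abelian isoG).
apply: isog_trans (isog_dihedral6 oG nabG) _.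
by rewrite isog_sym isog_dihedral6.
Qed.

Theorem theorem4p5 (gT : finGroupType) (G : {group gT}) :
  (two_centralizer 5 G <->
     (G \isog [set: 'S_3]) \/
     ('Z(G) <> 1 /\ G / 'Z(G) \isog [set: 'Z_2 * 'Z_2]))
  /\ (primitive_two_centralizer 5 G <-> G \isog [set: 'S_3]).
Proof.
have [abelV oV] := abelem_Z2_Z2.
have S3P : G \isog [set: 'S_3] -> primitive_two_centralizer 5 G.
  move=> isoG; have /isog_S3P[oG nabG] := isoG.
  have Z1 := center_TI_cent nabG (TI_cent_order6 oG).
  split; first exact: two_centralizer5_order6.
  have /isog_S3P[oQ nabQ]: G / 'Z(G) \isog [set: 'S_3].
    by rewrite Z1 -(isog_transl _ (quotient1_isog G)).
  exact: two_centralizer5_order6.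
have nab (hT : finGroupType) (H : {group hT}) : two_centralizer 5 H -> ~~ abelian H.
  by move=> card5; apply/negP => /two_Cent_abelian; rewrite card5.
have five : two_centralizer 5 G ->
    G \isog [set: 'S_3] \/ 'Z(G) <> 1 /\ G / 'Z(G) \isog [set: 'Z_2 * 'Z_2].
  move=> card5; have nabG := nab _ _ card5.
  have [Z1 | ntZ] := eqVneq 'Z(G) 1.
    by left; apply/isog_S3P; rewrite card6_of_two_centralizer5.
  right; split; first exact/eqP.
  have card3: #|noncentral_cents G| = 3.
    apply/eqP; rewrite eqn_leq card_noncentral_cents_ge3 // andbT.
    by have := card_two_Cent_ge_center nabG ntZ; rewrite card5.
  have [abelQ oQ] := abelem_quotient_center nabG card3.
  by rewrite (isog_abelem_card _ abelQ) abelV oV oQ.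
split; split=> //.
- case=> [/S3P[] // | [/eqP ntZ isoQ]].
  by apply: two_centralizer5_center => //; rewrite (card_isog isoQ).
(* A Klein four-group quotient is abelian, so it has at most one member in its 2-Cent, not five. *)
- case=> /five[// | [_ isoQ]] /nab/negP[].
  by rewrite (isog_abelian isoQ) (abelem_abelian abelV).
Qed.
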